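(* Let $\mathcal{G}=(V,E,\mathrm{init},\mathrm{ter})$ be a finite loop-free directed graph with $n$ vertices and $m$ edges, let $S\subset V$ contain at most one vertex from each connected component of $\mathcal{G}$, and let $A\in\mathbb{R}^{(n-|S|)\times m}$ be obtained from the incidence matrix of $\mathcal{G}$ by deleting the rows corresponding to the vertices in $S$. Define \[ \mathcal{D}^S_K(\mathcal{G}):=\left\{(j,i,\phi,u)\in\mathbb{R}^{n-|S|}\times\mathbb{R}^m\times\mathbb{R}^{n-|S|}\times\mathbb{R}^m \;\middle|\; \begin{bmatrix} I & A \\ 0 & 0 \end{bmatrix}\begin{pmatrix} j \\ i \end{pmatrix}+\begin{bmatrix} 0 & 0 \\ A^\top & -I \end{bmatrix}\begin{pmatrix} \phi \\ u \end{pmatrix}=0\right\} \] (with flow $(j,i)$ and effort $(\phi,u)$) and \[ \mathcal{L}^S_K(\mathcal{G}):=\{0\}\times\mathbb{R}^{n-|S|}\subset\mathbb{R}^{n-|S|}\times\mathbb{R}^{n-|S|}. \] Then: (i) $\mathcal{D}^S_K(\mathcal{G})$ is a Dirac structure, and $\mathcal{L}^S_K(\mathcal{G})$ is a Lagrange submanifold of $\mathbb{R}^{n-|S|}\times\mathbb{R}^{n-|S|}$. (ii) For functions $q,\phi$ with values in $\mathbb{R}^{n-|S|}$ and $i,u$ with values in $\mathbb{R}^m$, defined on an interval, with $q$ differentiable, the relations \[ \left(-\tfrac{d}{dt}q(t),i(t),\phi(t),u(t)\right)\in\mathcal{D}^S_K(\mathcal{G}),\qquad (q(t),\phi(t))\in\mathcal{L}^S_K(\mathcal{G})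 \] hold for all $t$ if, and only if, for all $t$, \[ q(t)=0,\qquad A\,i(t)=0,\qquad A^\top\phi(t)=u(t). \] In particular, in this case $i(t)\in\ker A$ and $u(t)\in\operatorname{im}A^\top$ for all $t$.
   Context: A directed graph $\mathcal{G}=(V,E,\mathrm{init},\mathrm{ter})$ consists of a vertex set $V$, an edge set $E$ and maps $\mathrm{init},\mathrm{ter}:E\to V$ (initial and terminal vertex); it is loop-free if $\mathrm{init}(e)\ne\mathrm{ter}(e)$ for all $e\in E$. Multiple edges between the same vertices are allowed. Connected components are those of the underlying undirected graph. With $V=\{v_1,\dots,v_n\}$, $E=\{e_1,\dots,e_m\}$, the incidence matrix $A_0=(a_{jk})\in\mathbb{R}^{n\times m}$ has $a_{jk}=1$ if $\mathrm{init}(e_k)=v_j$, $a_{jk}=-1$ if $\mathrm{ter}(e_k)=v_j$, and $a_{jk}=0$ otherwise. A subspace $\mathcal{D}\subset\mathbb{R}^N\times\mathbb{R}^N$ (pairs of a flow $f$ and an effort $e$) is a Dirac structure if for all $f,e\in\mathbb{R}^N$: $(f,e)\in\mathcal{D}\iff\forall(\hat f,\hat e)\in\mathcal{D}:\ e^\top\hat f+\hat e^\top f=0$. A submanifold $\mathcal{L}\subset\mathbb{R}^N\times\mathbb{R}^N$ is a Lagrange submanifold if for all $x\in\mathcal{L}$ and $(v_1,v_2)\in\mathbb{R}^N\times\mathbb{R}^N$: $(v_1,v_2)\in T_x\mathcal{L}\iff\forall(w_1,w_2)\in T_x\mathcal{L}:\ v_1^\top w_2-v_2^\top w_1=0$.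 *)

(* Defs.v *)
From HB Require Import structures.
From mathcomp Require Import all_boot all_order all_algebra.
From mathcomp Require Import all_classical all_reals all_analysis.

Set Implicit Arguments.
Unset Strict Implicit.
Unset Printing Implicit Defensive.

Import Order.TTheory GRing.Theory Num.Theory.
Import numFieldNormedType.Exports.

Local Open Scope classical_set_scope.
Local Open Scope ring_scope.

Record digraph (V E : finType) := Digraph { init : E -> V; ter : E -> V }.

Section Graphs.
Variables (V E : finType) (G : digraph V E).

Definition loop_free := forall e : E, init G e != ter G e.

(* adjacency in the underlying undirected graph *)
Definition adj : rel V := fun v w =>
  [exists e : E, ((init G e == v) && (ter G e == w))
                 || ((init G e == w) && (ter G e == v))].

Definition at_most_one_per_component (S : {set V}) :=
  forall v w : V, v \in S -> w \in S -> connect adj v w -> v = w.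

Variable R : realType.

(* Vertices and edges are numbered by their position in [enum]. *)
Definition incidence : 'M[R]_(#|V|, #|E|) :=
  \matrix_(j, k)
    if init G (enum_val k) == enum_val j then 1
    else if ter G (enum_val k) == enum_val j then -1
    else 0.

(* The remaining rows are indexed by the complement of S, of cardinality
   #|V| - #|S|, and kept in the same order. *)
Definition reduced_incidence (S : {set V}) : 'M[R]_(#|~: S|, #|E|) :=
  rowsub (fun j : 'I_#|~: S| => enum_rank (enum_val j)) incidence.

End Graphs.

Section LinearAlgebra.
Variable R : realType.

Definition ker_mx m n (B : 'M[R]_(m, n)) : set 'cV[R]_n :=
  [set x | B *m x = 0].

Definition im_mx m n (B : 'M[R]_(m, n)) : set 'cV[R]_m :=
  range (fun x : 'cV[R]_n => B *m x).

Definition is_subspace (W : lmodType R) (D : set W) :=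
  submod_closed (mem D).

Definition Dirac_structure N (D : set ('cV[R]_N * 'cV[R]_N)) :=
  is_subspace D /\
  forall f e : 'cV[R]_N,
    D (f, e) <->
    forall f' e' : 'cV[R]_N, D (f', e') -> e^T *m f' + e'^T *m f = 0.

End LinearAlgebra.

Section Submanifolds.
Variable R : realType.

(* For finite-dimensional X: f is C^k on the open set U iff all its iterated
   directional derivatives up to order k exist and are continuous on U. *)
Fixpoint Ck_on (X Y : normedModType R) (k : nat) (U : set X) (f : X -> Y)
    : Prop :=
  match k with
  | 0 => forall x, U x -> {for x, continuous f}
  | k'.+1 => (forall x, U x -> differentiable f x) /\
             (forall v : X, Ck_on k' U ('D_v f))
  end.

Definition smooth_on (X Y : normedModType R) (U : set X) (f : X -> Y) :=
  forall k, Ck_on k U f.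

Definition diffeo_on (X : normedModType R) (U W : set X) (f : X -> X) :=
  open U /\ open W /\ smooth_on U f /\ f @` U = W /\
  exists g : X -> X, smooth_on W g /\ forall x, U x -> g (f x) = x.

(* Smooth embedded submanifold of a finite-dimensional space X: around each of
   its points a diffeomorphism flattens M onto an open part of a linear
   subspace F.  As F does not depend on the point, M has constant dimension
   dim F; up to a linear isomorphism F is a coordinate subspace. *)
Definition submanifold (X : normedModType R) (M : set X) :=
  exists F : set X, is_subspace F /\
    forall x, M x -> exists U W f,
      U x /\ diffeo_on U W f /\ f @` (M `&` U) = F `&` W.

(* velocities at x of smooth curves in M through x *)
Definition tangent_space (X : normedModType R) (M : set X) (x : X) : set X :=
  [set v | exists (r : R) (c : R^o -> X),
     [/\ 0 < r, smooth_on [set t : R^o | - r < t < r] c,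
         forall t, - r < t < r -> M (c t),
         c 0 = x & derive1 c 0 = v]].

Definition Lagrange_submanifold N (L : set ('cV[R]_N * 'cV[R]_N)) :=
  submanifold L /\
  forall x, L x -> forall v1 v2 : 'cV[R]_N,
    tangent_space L x (v1, v2) <->
    forall w1 w2 : 'cV[R]_N,
      tangent_space L x (w1, w2) -> v1^T *m w2 - v2^T *m w1 = 0.

End Submanifolds.

Section TimeDerivative.
Variables (R : realType) (Y : normedModType R).

(* Derivative relative to J: one-sided at an endpoint belonging to J. *)
Definition derivable_in (J : set R) (q : R -> Y) (t : R) : Prop :=
  cvg (h^-1 *: (q (h + t) - q t) @[h --> within [set h | J (h + t)] 0^']).

Definition deriv_in (J : set R) (q : R -> Y) (t : R) : Y :=
  lim (h^-1 *: (q (h + t) - q t) @[h --> within [set h | J (h + t)] 0^']).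

End TimeDerivative.

Section Kirchhoff.
Variables (R : realType) (k m : nat).

(* Elements are pairs (flow, effort), with flow (j, i) and effort (phi, u). *)
Definition Kirchhoff_Dirac (A : 'M[R]_(k, m))
    : set ('cV[R]_(k + m) * 'cV[R]_(k + m)) :=
  [set x | (block_mx 1%:M A 0 0 : 'M[R]_(k + m)) *m x.1 +
           (block_mx 0 0 A^T (- 1%:M) : 'M[R]_(k + m)) *m x.2 = 0].

Definition Kirchhoff_Lagrange : set ('cV[R]_k * 'cV[R]_k) :=
  [set 0] `*` setT.

End Kirchhoff.

Arguments Kirchhoff_Lagrange : clear implicits.

(* Main.v *)
(** On [D] the relations read [j = - A i] and [u = A^T phi], so the pairing of
    an arbitrary [(j, i, phi, u)] with the element [(- A i', i', phi', A^T phi')]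
    of [D] is [(u - A^T phi)^T i' + phi'^T (j + A i)]; it vanishes for all [i']
    and [phi'] exactly when both brackets do, hence [D] is Dirac.  [L] is a
    closed linear subspace, so it is its own tangent space at each of its
    points, and the Lagrange condition becomes [v1 = 0].  For the dynamics,
    [q = 0] throughout the interval forces [dq/dt = 0]. *)

Require Import Defs.
From HB Require Import structures.
From mathcomp Require Import all_boot all_order all_algebra.
From mathcomp Require Import all_classical all_reals all_analysis.
From mathcomp Require Import lra.

Set Implicit Arguments.
Unset Strict Implicit.
Unset Printing Implicit Defensive.

Import Order.TTheory GRing.Theory Num.Theory.
Import numFieldNormedType.Exports.

Local Open Scope classical_set_scope.
Local Open Scope ring_scope.

Section KirchhoffDirac.
Variables (R : realType) (k m : nat) (A : 'M[R]_(k, m)).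

Lemma Kirchhoff_DiracE (j : 'cV[R]_k) (i : 'cV[R]_m) (phi : 'cV[R]_k)
    (u : 'cV[R]_m) :
  Kirchhoff_Dirac A (col_mx j i, col_mx phi u) <->
  j + A *m i = 0 /\ A^T *m phi = u.
Proof.
rewrite /Kirchhoff_Dirac /= !mul_block_col !mul0mx mul1mx mulNmx mul1mx.
rewrite !addr0 add_col_mx addr0 add0r -[X in _ = X]col_mx0.
split=> [/eq_col_mx[-> /eqP]|[-> ->]]; last by rewrite subrr.
by rewrite subr_eq0 => /eqP.
Qed.

Lemma Kirchhoff_Dirac_subspace : is_subspace (Kirchhoff_Dirac A).
Proof.
split=> [|a x y]; rewrite !inE /Kirchhoff_Dirac /=; first by rewrite !mulmx0 addr0.
move=> hx hy; rewrite !mulmxDr -!scalemxAr addrACA -scalerDr.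
by rewrite hx hy scaler0 addr0.
Qed.

(** Transposition moves [A] across the pairing: [phi^T A i' = (A^T phi)^T i'] joins the term in [u],
    and [(A^T phi')^T i = phi'^T A i] joins the term in [j]. *)
Lemma Kirchhoff_pairing (j phi phi' : 'cV[R]_k) (i u i' : 'cV[R]_m) :
  (col_mx phi u)^T *m col_mx (- (A *m i')) i' +
    (col_mx phi' (A^T *m phi'))^T *m col_mx j i =
  (u - A^T *m phi)^T *m i' + phi'^T *m (j + A *m i).
Proof.
rewrite !tr_col_mx !mul_row_col mulmxN !linearB /= !trmx_mul !trmxK.
by rewrite mulmxBl mulmxDr !mulmxA (addrC (- _)).
Qed.

(** Nondegeneracy of the standard pairing: testing against the basis vector [delta_mx a 0] reads off
    coordinate [a]. *)
Lemma trmx_mul_eq0 p (x : 'cV[R]_p) : (forall y : 'cV[R]_p, y^T *m x = 0) -> x = 0.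
Proof.
move=> x0; apply/colP => a; have /matrixP/(_ 0 0) := x0 (delta_mx a 0).
by rewrite trmx_delta -rowE !mxE.
Qed.

Lemma Kirchhoff_Dirac_structure : Dirac_structure (Kirchhoff_Dirac A).
Proof.
split; first exact: Kirchhoff_Dirac_subspace.
move=> f e; rewrite -[f]vsubmxK -[e]vsubmxK.
set j := usubmx f; set i := dsubmx f; set phi := usubmx e; set u := dsubmx e.
rewrite Kirchhoff_DiracE; split=> [[ji0 phiu] f' e'|orth].
  rewrite -[f']vsubmxK -[e']vsubmxK => /Kirchhoff_DiracE[/eqP + <-].
  rewrite addr_eq0 => /eqP ->.
  by rewrite Kirchhoff_pairing ji0 phiu subrr trmx0 mul0mx mulmx0 addr0.
have {}orth i' phi' : (u - A^T *m phi)^T *m i' + phi'^T *m (j + A *m i) = 0.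
  rewrite -Kirchhoff_pairing; apply: orth; apply/Kirchhoff_DiracE.
  by rewrite addNr.
split.
  (* Setting [i' = 0] isolates the first relation; setting [phi' = 0] below isolates the second. *)
  apply: trmx_mul_eq0 => phi'.
  by rewrite -(orth 0 phi') mulmx0 add0r.
apply/esym/eqP; rewrite -subr_eq0; apply/eqP/trmx_mul_eq0 => i'.
have := orth i' 0; rewrite trmx0 mul0mx addr0 => /(congr1 trmx).
by rewrite trmx_mul trmxK trmx0.
Qed.

End KirchhoffDirac.

Section AffineSmooth.
Variables (R : realType) (X Y : normedModType R).

Lemma smooth_on_cst (U : set X) (y : Y) : smooth_on U (cst y).
Proof.
(* The induction generalises [y], because differentiation replaces the constant [y] by [0]. *)
move=> n; elim: n y => [|n IHn] y /=; first by move=> x _; exact: cst_continuous.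
split=> [x _|v]; first exact: differentiable_cst.
have -> : 'D_v (cst y : X -> Y) = cst 0 by apply/funext => x; exact: derive_cst.
exact: IHn.
Qed.

(** After one differentiation only a constant is left, whose further derivatives vanish; the
    identity and affine lines are of this kind. *)
Lemma smooth_on_cst_derive (U : set X) (f : X -> Y) :
  (forall x, differentiable f x) -> (forall v, exists y, 'D_v f = cst y) ->
  smooth_on U f.
Proof.
move=> df Df [|n] /=; first by move=> x _; exact: differentiable_continuous.
by split=> [x _ //|v]; have [y ->] := Df v; exact: smooth_on_cst.
Qed.

End AffineSmooth.

Section LinearSubmanifolds.
Variables (R : realType) (X : normedModType R).

Lemma smooth_on_id (U : set X) : smooth_on U (fun x => x).
Proof.
apply: smooth_on_cst_derive => // v; exists v.
by apply/funext => x; exact: derive_id.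
Qed.

Lemma is_derive_line (x w : X) (t v : R^o) :
  is_derive t v (fun s : R^o => x + s *: w) (v *: w).
Proof.
have dx : is_derive t v (cst x : R^o -> X) 0 := is_derive_cst _ _ _.
have dw : is_derive t v (fun s : R^o => s *: w) (v *: w).
  apply: DeriveDef; first exact: diff_derivable.
  rewrite deriveE//.
  by rewrite (diff_val (f := fun s : R^o => s *: w)).
by have := is_deriveD dx dw; rewrite add0r.
Qed.

Lemma smooth_on_line (U : set R^o) (x w : X) :
  smooth_on U (fun t : R^o => x + t *: w).
Proof.
apply: smooth_on_cst_derive => [t|v]; first exact: differentiableD.
exists (v *: w); apply/funext => t.
by have dl := is_derive_line x w t v; rewrite derive_val.
Qed.

(** The identity of the whole space is a global flattening chart, with model [F = M]. *)
Lemma subspace_submanifold (M : set X) : is_subspace M -> submanifold M.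
Proof.
move=> Msub; exists M; split=> // x Mx; exists setT, setT, (fun x => x).
rewrite !image_id; split=> //; split=> //.
do !split; rewrite ?image_id//; try exact: openT; try exact: smooth_on_id.
by exists (fun x => x); split => //; exact: smooth_on_id.
Qed.

(** A vector of [M] is the velocity of a straight line through [x] inside [M]. Conversely, the
    difference quotients of a curve in [M] lie in [M] by linearity, and closedness passes this on to
    their limit. *)
Lemma tangent_space_closed_subspace (M : set X) (x : X) :
  is_subspace M -> closed M -> M x -> tangent_space M x = M.
Proof.
move=> [M0 Mlin] clM Mx; apply/seteqP; split=> v; last first.
  move=> Mv; exists 1, (fun t => x + t *: v); split => //.
  - exact: smooth_on_line.
  - move=> t _; rewrite addrC; apply/set_mem.
    by apply: Mlin; exact: mem_set.
  - by rewrite scale0r addr0.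
  - rewrite derive1E; have dl := is_derive_line x v 0 1.
    by rewrite derive_val scale1r.
move=> [r [c [r0 /(_ 1%N)[dc _] cM c0 <-]]].
have cdrv : derivable c 0 1.
  by apply/diff_derivable/dc; rewrite /= oppr_lt0 r0.
rewrite derive1E; apply: (closed_cvg M clM _ _ cdrv).
near=> h; apply/set_mem.
(* The quotient is brought to the shape [a *: x + y] of [submod_closed], nested twice; the final [0]
   is the outer [y]. *)
have -> : h^-1 *: (c (h *: 1 + 0) - c 0) = h^-1 *: (- 1 *: c 0 + c h) + 0.
  by rewrite !addr0 scaleN1r addrC [h *: 1]mulr1.
apply: (Mlin) => //; apply: Mlin; apply/mem_set; apply: cM.
  by rewrite oppr_lt0 r0.
rewrite -ltr_norml; near: h; apply: dnbhs0_lt => //.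
Unshelve. all: by end_near. Qed.

End LinearSubmanifolds.

Section KirchhoffLagrange.
Variables (R : realType) (k : nat).

Lemma Kirchhoff_Lagrange_subspace : is_subspace (Kirchhoff_Lagrange R k).
Proof.
split=> [|a x y]; rewrite !inE /Kirchhoff_Lagrange /=; first by [].
by move=> [-> _] [-> _]; rewrite scaler0 addr0.
Qed.

Lemma Kirchhoff_Lagrange_closed : closed (Kirchhoff_Lagrange R k).
Proof.
have -> : Kirchhoff_Lagrange R k = fst @^-1` [set 0].
  by apply/seteqP; split=> x /=; [case|split].
apply: closed_comp; first by move=> x _; exact: cvg_fst.
exact/accessible_closed_set1/hausdorff_accessible/norm_hausdorff.
Qed.

Lemma Kirchhoff_Lagrange_submanifold :
  Lagrange_submanifold (Kirchhoff_Lagrange R k).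
Proof.
have subL := Kirchhoff_Lagrange_subspace.
split=> [|x Lx v1 v2]; first exact: subspace_submanifold.
rewrite (tangent_space_closed_subspace subL Kirchhoff_Lagrange_closed Lx).
split=> [[/= -> _] w1 w2 [/= -> _]|orth].
  by rewrite trmx0 mul0mx mulmx0 subr0.
split=> //=; apply: trmx_mul_eq0 => w.
(* The test vector is [(0, w)], which lies in the Lagrange subspace for every [w]. *)
have /(congr1 trmx) : v1^T *m w - v2^T *m 0 = 0 by apply: orth.
by rewrite mulmx0 subr0 trmx_mul trmxK trmx0.
Qed.

End KirchhoffLagrange.

Section IntervalDerivative.
Variables (R : realType) (Y : normedModType R).

(** Properness makes limits along this filter unique, so that the [lim] in [deriv_in] can be
    computed. It holds because a nondegenerate interval has points other than [t] arbitrarily close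
    to [t], on at least one side. *)
Lemma within_interval_proper (J : set R) (t : R) :
  is_interval J -> (exists a b : R, [/\ J a, J b & a < b]) -> J t ->
  ProperFilter (within [set h | J (h + t)] (0 : R)^').
Proof.
move=> Jint [a [b [Ja Jb ab]]] Jt.
have [s Js st] : exists2 s, J s & s != t.
  have [at_|] := eqVneq a t; last by exists a.
  by exists b => //; rewrite -at_ gt_eqF.
apply: Build_ProperFilter_ex => P.
rewrite /within /= => -[e /= e0 eP].
(* The interval J contains a point s <> t, hence the step +-d towards s. *)
pose d := Num.min (e / 2) `|s - t|.
have d0 : 0 < d by rewrite lt_min divr_gt0// normr_gt0 subr_eq0.
have de : d < e by rewrite gt_min ltr_pdivrMr// ltr_pMr// ltr1n.
have ds : d <= `|s - t| by rewrite ge_min lexx orbT.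
have [lst|lts] := ltP s t.
  exists (- d); apply: eP => /=.
  - by rewrite sub0r opprK gtr0_norm.
  - by rewrite oppr_eq0 gt_eqF.
  - apply: (Jint s t) => //; move: ds; rewrite ltr0_norm ?subr_lt0//.
    by move=> ds; apply/andP; split; lra.
exists d; apply: eP => /=.
- by rewrite sub0r normrN gtr0_norm.
- by rewrite gt_eqF.
- apply: (Jint t s) => //; move: ds; rewrite ger0_norm ?subr_ge0//.
  by move=> ds; apply/andP; split; lra.
Qed.

(** Every difference quotient taken inside [J] is zero, and limits along the proper filter are
    unique. *)
Lemma deriv_in_eq0 (J : set R) (q : R -> Y) (t : R) :
  is_interval J -> (exists a b : R, [/\ J a, J b & a < b]) ->
  (forall s, J s -> q s = 0) -> J t -> deriv_in J q t = 0.
Proof.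
move=> Jint Jnd q0 Jt; have pf := within_interval_proper Jint Jnd Jt.
apply: cvg_lim; first exact: norm_hausdorff.
apply: cvg_near_cst; rewrite near_withinE; apply: nearW => h Jh.
by rewrite !q0// subr0 scaler0.
Qed.

End IntervalDerivative.

Theorem mainTheorem2 (R : realType) (V E : finType) (G : digraph V E)
    (S : {set V}) (G_loop_free : loop_free G)
    (S_comp : at_most_one_per_component G S) :
  let k := #|~: S| in
  let m := #|E| in
  let A : 'M[R]_(k, m) := reduced_incidence G R S in
  let D := Kirchhoff_Dirac A in
  let L := Kirchhoff_Lagrange R k in
  (Dirac_structure D /\ Lagrange_submanifold L) /\
  (forall (J : set R) (q phi : R -> 'cV[R]_k) (i u : R -> 'cV[R]_m),
     is_interval J ->
     (exists a b : R, [/\ J a, J b & a < b]) ->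
     (forall t, J t -> derivable_in J q t) ->
     let relations :=
       forall t, J t ->
         D (col_mx (- deriv_in J q t) (i t), col_mx (phi t) (u t)) /\
         L (q t, phi t) in
     (relations <->
        forall t, J t -> [/\ q t = 0, A *m i t = 0 & A^T *m phi t = u t]) /\
     (relations ->
        forall t, J t -> ker_mx A (i t) /\ im_mx A^T (u t))).
Proof.
move=> k m A D L; split.
  by split; [exact: Kirchhoff_Dirac_structure|exact: Kirchhoff_Lagrange_submanifold].
move=> J q phi i u Jint Jnd _ relations.
have relE : relations <->
    forall t, J t -> [/\ q t = 0, A *m i t = 0 & A^T *m phi t = u t].
  split=> [rel t Jt|eqs t Jt].
    (* The constraint is extracted on all of [J], since the derivative at [t] depends on
       neighbouring values of [q]. *)
    have q0 s : J s -> q s = 0 by move=> /rel[_ []].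
    have [/Kirchhoff_DiracE[+ ->] _] := rel t Jt.
    by rewrite (deriv_in_eq0 Jint Jnd q0 Jt) oppr0 add0r q0.
  have q0 s : J s -> q s = 0 by move=> /eqs[].
  have [_ Ai Aphi] := eqs t Jt.
  split; last by split=> //; exact: q0.
  apply/Kirchhoff_DiracE.
  by rewrite (deriv_in_eq0 Jint Jnd q0 Jt) oppr0 add0r.
split=> // /relE eqs t /eqs[_ Ai Aphi].
by split=> //; exists (phi t).
Qed.
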